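(* Let $n\ge1$ and let $P\subseteq\mathcal{B}_n$ be the set of $\sigma$-positive elements. For each $\phi\in\mathcal{B}_n$, exactly one of the following holds: - $\phi=1$; - $\phi\in P$; - $\phi^{-1}\in P$. Moreover $PP\subseteq P$, so $P$ is the positive cone of a right-invariant total ordering of $\mathcal{B}_n$.
   Context: $\Sigma_{0,1,n}$ is the free group with free basis $t_1,\dots,t_n$, and $z_1:=(t_1\cdots t_n)^{-1}$. Automorphisms act on the right and compose left to right. $\mathcal{B}_n$ is the group of all automorphisms $\phi$ of $\Sigma_{0,1,n}$ such that $z_1^\phi=z_1$ and $\phi$ permutes the set of conjugacy classes $\{[t_1],\dots,[t_n]\}$. For $i\in\{1,\dots,n-1\}$, $\sigma_i$ is given by $t_k^{\sigma_i}=t_k$ for $k\notin\{i,i+1\}$, $t_i^{\sigma_i}=t_{i+1}$, and $t_{i+1}^{\sigma_i}=t_{i+1}^{-1}t_it_{i+1}$. An element $\phi\in\mathcal{B}_n$ is $\sigma$-positive if $n\ge2$ and, for some $i\in\{1,\dots,n-1\}$, $\phi$ is a product of a finite sequence of elements of $\{\sigma_i,\dots,\sigma_{n-1}\}\cup\{\sigma_{i+1}^{-1},\dots,\sigma_{n-1}^{-1}\}$ in which $\sigma_i$ occurs at least once. *)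

(* Defs.v *)
(* Free group Sigma_{0,1,n} on t_1..t_n as reduced words,
   automorphisms given by the images of the free generators (right action). *)
From mathcomp Require Import all_boot all_fingroup.
Set Implicit Arguments. Unset Strict Implicit. Unset Printing Implicit Defensive.

(* a letter (k, b) stands for t_k if b = false and t_k^{-1} if b = true *)
Definition letter := (nat * bool)%type.
Definition word := seq letter.

Definition linv (x : letter) : letter := (x.1, ~~ x.2).

Definition red_push (x : letter) (s : word) : word :=
  match s with
  | y :: s' => if y == linv x then s' else x :: s
  | [::] => [:: x]
  end.
Definition reduce (w : word) : word := foldr red_push [::] w.

Definition winv (w : word) : word := rev (map linv w).
Definition wmul (u v : word) : word := reduce (u ++ v).
Definition gen (k : nat) : word := [:: (k, false)].

Definition in_F (n : nat) (w : word) : bool :=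
  (reduce w == w) && all (fun x => (0 < x.1) && (x.1 <= n)) w.

(* an endomorphism is given by the images img k of the generators t_k *)
Definition endo := nat -> word.

Definition ext (img : endo) (w : word) : word :=
  reduce (flatten (map (fun x => if x.2 then winv (img x.1) else img x.1) w)).

(* composition left to right: t^(phi psi) = (t^phi)^psi *)
Definition acomp (phi psi : endo) : endo := fun k => ext psi (phi k).
Definition idE : endo := gen.

Definition aut_eq (n : nat) (phi psi : endo) : Prop :=
  forall k, 0 < k <= n -> phi k = psi k.

Definition is_aut (n : nat) (phi : endo) : Prop :=
  (forall k, 0 < k <= n -> in_F n (phi k)) /\
  (forall u v, in_F n u -> in_F n v -> ext phi u = ext phi v -> u = v) /\
  (forall v, in_F n v -> exists2 u, in_F n u & ext phi u = v).

Definition z1 (n : nat) : word := winv [seq (k, false) | k <- iota 1 n].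

Definition conjF (n : nat) (u v : word) : Prop :=
  exists2 w, in_F n w & u = reduce (winv w ++ v ++ w).

Definition inB (n : nat) (phi : endo) : Prop :=
  is_aut n phi /\ ext phi (z1 n) = z1 n /\
  exists s : {perm 'I_n}, forall k : 'I_n, conjF n (phi k.+1) (gen (s k).+1).

Definition sigma (i : nat) : endo := fun k =>
  if k == i then gen i.+1
  else if k == i.+1 then [:: (i.+1, true); (i, false); (i.+1, false)]
  else gen k.
Definition sigma_inv (i : nat) : endo := fun k =>
  if k == i then [:: (i, false); (i.+1, false); (i, true)]
  else if k == i.+1 then gen i
  else gen k.

Definition sgen (x : nat * bool) : endo :=
  if x.2 then sigma_inv x.1 else sigma x.1.
Definition sprod (l : seq (nat * bool)) : endo := foldr (fun x acc => acomp (sgen x) acc) idE l.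

Definition sigma_pos (n : nat) (phi : endo) : Prop :=
  2 <= n /\
  exists i, [/\ 0 < i <= n.-1 &
    exists l : seq (nat * bool),
      [/\ all (fun x => (i <= x.1 <= n.-1) && (x.2 ==> (i < x.1))) l,
          (i, false) \in l & aut_eq n phi (sprod l)]].

(* Main.v *)
Require Import Defs.
From mathcomp Require Import all_boot all_fingroup zify.
From Corelib Require Import Setoid Morphisms.
Set Implicit Arguments. Unset Strict Implicit. Unset Printing Implicit Defensive.

(** An automorphism [phi] in [B_n] is the tuple [g_k = phi k] of conjugates of generators
    with product [t_1 ... t_n], and multiplying [phi] on the left by [sigma_k^{+-1}] is a
    Hurwitz move on the entries [k], [k+1].

    Existence.  If [g_i = t_i] pass to the index [i+1].  Otherwise shorten the tail
    [g_{i+1}, ..., g_n] by moves [sigma_k^{+-1}], [k > i], as long as possible.  Writing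
    [g_k = w_k^-1 x_k w_k], no middle letter [x_k], [k > i], is then cancelled in the tail
    product [R], which also equals [g_i^-1 t_i ... t_n].  If [g_i] starts with [t_i], a
    length count puts [x_{i+1}] inside the prefix [w_i^-1] of [R]; hence [g_{i+1}], the new
    first entry after a [sigma_i] move, is shorter and again starts with [t_i].  If [g_i]
    does not start with [t_i], then [R] is the reduced word
    [w_i^-1 x_i^-1 w_i t_i ... t_n], and a length count puts some [x_k] inside the factor
    [w_i t_i]; bringing [g_k] to the front by inverse moves gives a first entry that is
    [t_i], or is shorter than [g_i] and does not start with [t_i].  Iterating writes [phi]
    as a [sigma_i]-negative, respectively [sigma_i]-positive, word times a word in the
    [sigma_k^{+-1}] with [k > i].

    Exclusivity.  A reduced word starting with [t_i] still starts with [t_i] after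
    [sigma_i^-1] and after [sigma_k^{+-1}], [k > i]; so a word in these that involves
    [sigma_i^-1] maps [t_i] to a word that starts with [t_i] and is longer than [t_i]. *)

(** * Reduced words *)

Definition wred (w : word) := sorted (fun x y => y != linv x) w.

(* A variant rather than a definition, so that [rewrite] treats it as a setoid
   relation instead of unfolding it to an equation between reduced words. *)
Variant eqw (u v : word) : Prop := Eqw of reduce u = reduce v.
Infix "=w" := eqw (at level 70).

Lemma eqwP u v : u =w v <-> reduce u = reduce v.
Proof. by split=> [[]|]. Qed.

Lemma linvK : involutive linv.
Proof. by case=> k b; rewrite /linv /= negbK. Qed.

Lemma linv_neq x : x != linv x.
Proof. by case: x => k b; rewrite /linv xpair_eqE eqxx /=; case: b. Qed.

Lemma linv_eq x y : (x == linv y) = (y == linv x).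
Proof. by apply/eqP/eqP => ->; rewrite linvK. Qed.

Lemma wred_push x s : wred s -> wred (red_push x s).
Proof.
case: s => //= y s; case: eqP => [_|/eqP ne] /=; first exact: path_sorted.
by rewrite ne.
Qed.

Lemma wred_reduce w : wred (reduce w).
Proof. by elim: w => //= x w; apply: wred_push. Qed.

Lemma reduce_id w : wred w -> reduce w = w.
Proof.
elim: w => // x w IH r; rewrite [LHS]/= IH; last exact: path_sorted r.
by case: w r {IH} => //= y w /andP[/negPf->].
Qed.

Lemma reduceK w : reduce (reduce w) = reduce w.
Proof. exact/reduce_id/wred_reduce. Qed.

Lemma wredP w : reflect (reduce w = w) (wred w).
Proof.
by apply: (iffP idP) => [/reduce_id|<-]; last exact: wred_reduce.
Qed.

Lemma red_pushK x s : wred s -> red_push (linv x) (red_push x s) = s.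
Proof.
case: s => [|y s] /=; first by rewrite linvK eqxx.
case: eqP => [-> |_] r /=; last by rewrite linvK eqxx.
by case: s r => //= z s /andP[/negPf ->].
Qed.

Lemma reduce_cat u v : reduce (u ++ v) = foldr red_push (reduce v) u.
Proof. by rewrite /reduce foldr_cat. Qed.

Lemma wred_foldr u s : wred s -> wred (foldr red_push s u).
Proof. by move=> r; elim: u => //= x u; apply: wred_push. Qed.

(** A cancelling pair of letters acts trivially on reduced words by [red_pushK], so pushing letters
    is an action of the free group. This makes [++] compatible with [=w]. *)
Lemma foldr_reduce u s :
  wred s -> foldr red_push s (reduce u) = foldr red_push s u.
Proof.
move=> rs; elim: u => //= x u <-.
case: (reduce u) => //= y t; case: eqP => // ->.
by rewrite -{1}(linvK x) red_pushK //; apply: wred_foldr.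
Qed.

#[global] Instance eqw_equiv : Equivalence eqw.
Proof. by split=> [u|u v [e]|u v w [e] [e']] //; constructor; rewrite e. Qed.

#[global] Instance cat_eqw : Proper (eqw ==> eqw ==> eqw) (@cat letter).
Proof.
move=> u u' [eu] v v' [ev]; constructor; rewrite !reduce_cat ev.
by rewrite -[LHS]foldr_reduce ?eu ?foldr_reduce //; apply: wred_reduce.
Qed.

#[global] Instance cons_eqw x : Proper (eqw ==> eqw) (@cons letter x).
Proof. by move=> u v [e]; constructor; rewrite /= e. Qed.

Lemma reduce_eqw u : reduce u =w u.
Proof. by constructor; rewrite reduceK. Qed.

Lemma winv_cons x s : winv (x :: s) = winv s ++ [:: linv x].
Proof. by rewrite /winv /= rev_cons cats1. Qed.

Lemma winv_cat u v : winv (u ++ v) = winv v ++ winv u.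
Proof. by rewrite /winv map_cat rev_cat. Qed.

Lemma winvK : involutive winv.
Proof.
by move=> w; rewrite /winv -map_rev revK -map_comp map_id_in // => x _; apply: linvK.
Qed.

Lemma size_winv w : size (winv w) = size w.
Proof. by rewrite size_rev size_map. Qed.

Lemma wred_winv w : wred (winv w) = wred w.
Proof.
rewrite /wred /winv rev_sorted sorted_map; apply: eq_sorted => x y /=.
by rewrite (can_eq linvK) linv_eq.
Qed.

Lemma cat_winv w : w ++ winv w =w [::].
Proof.
elim: w => //= x w IH; rewrite winv_cons catA -cat1s.
rewrite (_ : [:: x] ++ (w ++ winv w) ++ [:: linv x] =w [:: x] ++ [::] ++ [:: linv x]).
  by constructor; rewrite /= eqxx.
by rewrite IH.
Qed.

Lemma winv_cat_id w : winv w ++ w =w [::].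
Proof. by rewrite -{2}(winvK w) cat_winv. Qed.

Lemma winvKcat w s : winv w ++ (w ++ s) =w s.
Proof. by rewrite catA winv_cat_id. Qed.

Lemma catKwinv w s : w ++ (winv w ++ s) =w s.
Proof. by rewrite catA cat_winv. Qed.

#[global] Instance winv_eqw : Proper (eqw ==> eqw) winv.
Proof.
move=> u v e; transitivity (winv u ++ (v ++ winv v)); first by rewrite cat_winv cats0.
have h x : u ++ x =w v ++ x by rewrite e.
by rewrite -h winvKcat.
Qed.

Lemma eqw_reduced u v : wred u -> wred v -> u =w v -> u = v.
Proof. by move=> /reduce_id ru /reduce_id rv [e]; rewrite -ru -rv. Qed.

(** [ext] without its final reduction: it commutes with [++] and [winv] on the nose, so computations
    run up to [=w] and are reduced once at the end. *)
Definition subst (f : endo) (w : word) : word :=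
  flatten [seq if x.2 then winv (f x.1) else f x.1 | x <- w].

Lemma extE f w : ext f w = reduce (subst f w). Proof. by []. Qed.

Lemma subst_cat f u v : subst f (u ++ v) = subst f u ++ subst f v.
Proof. by rewrite /subst map_cat flatten_cat. Qed.

Lemma subst_winv f w : subst f (winv w) = winv (subst f w).
Proof.
elim: w => //= x w IH; rewrite winv_cons subst_cat IH.
rewrite [in RHS]/subst /= winv_cat; congr (_ ++ _).
by rewrite /subst /= cats0; case: x => k [] /=; rewrite ?winvK.
Qed.

Lemma subst_gen f k : subst f (gen k) = f k.
Proof. by rewrite /subst /= cats0. Qed.

Lemma subst_reduce f w : subst f (reduce w) =w subst f w.
Proof.
elim: w => //= x w IH.
have -> : subst f (x :: w) = subst f [:: x] ++ subst f w by rewrite -subst_cat.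
rewrite -IH; case: (reduce w) => [|y t] /=; first by rewrite -subst_cat.
case: eqP => [->|_]; last by rewrite -subst_cat.
have -> : subst f (linv x :: t) = winv (subst f [:: x]) ++ subst f t.
  by rewrite -subst_winv -subst_cat.
by rewrite catKwinv.
Qed.

#[global] Instance subst_eqw f : Proper (eqw ==> eqw) (subst f).
Proof. by move=> u v [e]; rewrite -(subst_reduce f u) e subst_reduce. Qed.

Lemma ext_reduced f w : wred (ext f w).
Proof. exact: wred_reduce. Qed.

Lemma ext_eqw f w : ext f w =w subst f w.
Proof. by rewrite extE reduce_eqw. Qed.

Lemma subst_funeq (f g : endo) w : (forall k, f k =w g k) -> subst f w =w subst g w.
Proof.
move=> e; elim: w => //= -[k b] w IH.
have h (h : endo) : subst h ((k, b) :: w) =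
    (if b then winv (h k) else h k) ++ subst h w by [].
by rewrite !h IH; case: b {h}; rewrite e.
Qed.

Lemma eq_ext (f g : endo) w : f =1 g -> ext f w = ext g w.
Proof. by move=> e; rewrite !extE; apply/eqwP/subst_funeq => k; rewrite e. Qed.

Lemma subst_acomp f g w : subst (acomp f g) w =w subst g (subst f w).
Proof.
elim: w => //= -[k b] w IH.
have h (h : endo) : subst h ((k, b) :: w) =
    (if b then winv (h k) else h k) ++ subst h w by [].
rewrite !h IH subst_cat {h} /acomp; case: b; last by rewrite ext_eqw.
by rewrite ext_eqw subst_winv.
Qed.

Lemma ext_acomp f g w : ext (acomp f g) w = ext g (ext f w).
Proof. by rewrite !(extE _, extE g); apply/eqwP; rewrite subst_acomp -extE ext_eqw. Qed.

Lemma acompA f g h : acomp (acomp f g) h =1 acomp f (acomp g h).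
Proof. by move=> k; rewrite /acomp -ext_acomp. Qed.

Lemma subst_id w : subst idE w = w.
Proof. by elim: w => //= -[k b] w {2}<-; case: b. Qed.

Lemma ext_id w : wred w -> ext idE w = w.
Proof. by move=> r; rewrite extE subst_id reduce_id. Qed.

Lemma ext_gen f k : ext f (gen k) = reduce (f k).
Proof. by rewrite extE subst_gen. Qed.

Lemma acomp_idl f : (forall k, wred (f k)) -> acomp idE f =1 f.
Proof. by move=> r k; rewrite /acomp ext_gen reduce_id. Qed.

Lemma acomp_idr f : (forall k, wred (f k)) -> acomp f idE =1 f.
Proof. by move=> r k; rewrite /acomp ext_id. Qed.

Lemma eq_acomp f f' g g' : f =1 f' -> g =1 g' -> acomp f g =1 acomp f' g'.
Proof. by move=> ef eg k; rewrite /acomp ef; apply: eq_ext. Qed.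

(** * The generators [sigma_i^{+-1}] and their products *)

Lemma sgen_reduced x k : wred (sgen x k).
Proof.
by case: x => i [] /=; rewrite /sgen /= /sigma /sigma_inv; do 2?case: ifP => _ //=;
  rewrite /linv !xpair_eqE /= ?andbF ?(eqn_leq i) ?ltnn ?andbF.
Qed.

Lemma sprod_reduced l k : wred (sprod l k).
Proof. by case: l => [|x l] //; apply: ext_reduced. Qed.

Lemma sprod_cat l1 l2 : sprod (l1 ++ l2) =1 acomp (sprod l1) (sprod l2).
Proof.
elim: l1 => [|x l1 IH] k; first by rewrite acomp_idl //; apply: sprod_reduced.
by rewrite /= acompA; apply: eq_acomp.
Qed.

Lemma sigmaL i : sigma i i = gen i.+1.
Proof. by rewrite /sigma eqxx. Qed.

Lemma sigmaR i : sigma i i.+1 = winv (gen i.+1) ++ gen i ++ gen i.+1.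
Proof. by rewrite /sigma eqxx (_ : (i.+1 == i) = false) //; lia. Qed.

Lemma sigma_invL i : sigma_inv i i = gen i ++ gen i.+1 ++ winv (gen i).
Proof. by rewrite /sigma_inv eqxx. Qed.

Lemma sigma_invR i : sigma_inv i i.+1 = gen i.
Proof. by rewrite /sigma_inv eqxx (_ : (i.+1 == i) = false) //; lia. Qed.

Lemma sgen_out x k : k != x.1 -> k != x.1.+1 -> sgen x k = gen k.
Proof.
by case: x => i [] /= /negPf h1 /negPf h2; rewrite /sgen /sigma /sigma_inv /= h1 h2.
Qed.

Lemma sgen_inv x : acomp (sgen x) (sgen (linv x)) =1 idE.
Proof.
case: x => i b k; apply: eqw_reduced; rewrite ?ext_reduced // /acomp ext_eqw.
have [->|ni] := eqVneq k i; last have [->|nj] := eqVneq k i.+1.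
- case: b; rewrite /sgen /= ?sigmaL ?sigma_invL ?subst_cat ?subst_winv !subst_gen
    ?sigmaL ?sigmaR ?sigma_invR //.
  by rewrite -!catA catKwinv cat_winv.
- case: b; rewrite /sgen /= ?sigmaR ?sigma_invR ?subst_cat ?subst_winv !subst_gen
    ?sigmaL ?sigma_invL ?sigma_invR //.
  by rewrite -!catA winvKcat winv_cat_id.
- by rewrite !sgen_out // subst_gen sgen_out.
Qed.

Lemma wred_cat_cons s x t : wred (s ++ x :: t) = wred (rcons s x) && wred (x :: t).
Proof.
rewrite /wred; case: s => [|y s] //=.
by rewrite cat_path rcons_path /= andbA.
Qed.

Lemma size_reduce w : size (reduce w) <= size w.
Proof.
elim: w => //= x w; case: (reduce w) => //= y t; case: ifP => _ /=; lia.
Qed.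

(** * Conjugates of generators *)

Definition cform (w : word) (a : nat) : word := winv w ++ (a, false) :: w.
(* [conj_tail] and [conj_mid] recover [w] and [a] from [cform w a]; on words that are not
   of this form their values are junk. *)
Definition conj_tail (u : word) : word := drop (size u)./2.+1 u.
Definition conj_mid (u : word) : nat := (nth (0, false) u (size u)./2).1.

Lemma size_cform w a : size (cform w a) = (size w).*2.+1.
Proof. by rewrite size_cat /= size_winv; lia. Qed.

Lemma cform_tail w a : conj_tail (cform w a) = w.
Proof.
rewrite /conj_tail size_cform /= uphalf_double /cform -cat_rcons drop_size_cat //.
by rewrite size_rcons size_winv.
Qed.

Lemma cform_mid w a : conj_mid (cform w a) = a.
Proof.
by rewrite /conj_mid size_cform /= uphalf_double /cform nth_cat size_winv ltnn subnn.
Qed.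

Lemma cformE w a : cform w a = winv w ++ gen a ++ w.
Proof. by []. Qed.

Lemma wred_cform w a :
  wred (cform w a) = wred ((a, true) :: w) && wred ((a, false) :: w).
Proof.
by rewrite wred_cat_cons -[in RHS]wred_winv winv_cons cats1.
Qed.

Definition is_conj (u : word) : Prop := wred u /\ u = cform (conj_tail u) (conj_mid u).

Lemma is_conjP w a : wred (cform w a) -> is_conj (cform w a).
Proof. by split; rewrite // cform_tail cform_mid. Qed.

Lemma cform_strip w a : wred w -> exists s w',
  [/\ w = s ++ w', wred (cform w' a) & cform w' a =w cform w a].
Proof.
elim: w => [|b w IH] r; first by exists [::], [::].
have [eb|nb] := eqVneq b.1 a; last first.
  exists [::], (b :: w); split => //; rewrite wred_cform /wred /= in r *.
  rewrite r !andbT; case: b nb {r} => k c /= nk.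
  by rewrite !/(linv _) !xpair_eqE /= (negPf nk).
have [s [w' [h1 h2 h3]]] := IH (path_sorted r).
exists (b :: s), w'; split=> //; first by rewrite h1.
rewrite h3 !cformE winv_cons -[b :: w]cat1s -!catA.
have -> : [:: linv b] ++ gen a ++ [:: b] ++ w =w gen a ++ w; last by [].
rewrite -(_ : winv [:: b] = [:: linv b]) //.
case: b eb {r} => k c; rewrite [fst _]/= => ->; case: c; last by rewrite winvKcat.
by rewrite (_ : [:: (a, true)] = winv (gen a)) // winvK catKwinv.
Qed.

Lemma is_conj_gen k : is_conj (gen k).
Proof. exact: (@is_conjP [::]). Qed.

Lemma is_conj_ext phi w a : is_conj (phi a) -> is_conj (ext phi (cform w a)).
Proof.
case=> _ e; set v := conj_tail _ in e; set b := conj_mid _ in e.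
have [s [w' [_ h1 h2]]] := cform_strip b (wred_reduce (v ++ subst phi w)).
suff -> : ext phi (cform w a) = cform w' b by exact: is_conjP.
apply: eqw_reduced => //; first exact: ext_reduced.
rewrite ext_eqw h2 !cformE reduce_eqw !subst_cat subst_winv subst_gen e cformE winv_cat.
by rewrite -!catA.
Qed.

Lemma sgen_cform x k : exists w a, sgen x k = cform w a.
Proof.
case: x => i b.
have [->|ni] := eqVneq k i; last have [->|nj] := eqVneq k i.+1.
- case: b; rewrite /sgen /= ?sigmaL ?sigma_invL.
    by exists (winv (gen i)), i.+1.
  by exists [::], i.+1.
- case: b; rewrite /sgen /= ?sigmaR ?sigma_invR.
    by exists [::], i.
  by exists (gen i.+1), i.
- by exists [::], k; rewrite sgen_out.
Qed.

(** * Hurwitz moves *)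

Definition seg j m : word := [seq (k, false) | k <- iota j m].

Definition zword (i n : nat) : word := seg i (n.+1 - i).

Lemma segS j m : seg j m.+1 = seg j m ++ gen (j + m).
Proof. by rewrite /seg -addn1 iotaD map_cat. Qed.

Lemma zword_cons i n : i <= n -> zword i n = (i, false) :: zword i.+1 n.
Proof. by move=> h; rewrite /zword subSn //= subSS. Qed.

Lemma subst_cons f k w : subst f ((k, false) :: w) = f k ++ subst f w.
Proof. by []. Qed.

Lemma subst_zword_id f i n : (forall k, i <= k <= n -> f k = gen k) ->
  subst f (zword i n) = zword i n.
Proof.
move=> h; rewrite -[RHS]subst_id /zword /seg /subst -!map_comp; congr flatten.
by apply/eq_in_map => k; rewrite mem_iota /= => hk; apply: h; lia.
Qed.

Lemma sgen_zword x i n : i <= x.1 < n -> subst (sgen x) (zword i n) =w zword i n.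
Proof.
case: x => j b /= h; have {h} [hi hj] := andP h.
move em: (j - i) => m; elim: m i hi em => [|m IH] i hi em.
  have ->: i = j by lia.
  rewrite zword_cons; last lia.
  rewrite zword_cons; last lia.
  rewrite !subst_cons subst_zword_id; last by move=> k hk; apply: sgen_out => /=; lia.
  rewrite -[_ :: _]cat1s -[(j.+1, _) :: _]cat1s -!/(gen _).
  case: b; rewrite /sgen /= ?sigma_invL ?sigma_invR ?sigmaL ?sigmaR -!catA.
    by rewrite winvKcat.
  by rewrite catKwinv.
rewrite zword_cons; last lia.
rewrite subst_cons IH; [|lia|lia].
by rewrite sgen_out //=; lia.
Qed.

(** The form of membership in [B_n] used for the descent. It survives left multiplication by
    [sigma_k^{+-1}], [i <= k < n], and passing to [i + 1] once [phi i = t_i]. Fixing the values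
    outside the range allows equalities of maps to be stated with [=1]. *)
Record hurwitz (i n : nat) (phi : endo) : Prop := Hurwitz {
  hurwitz_conj : forall k, is_conj (phi k);
  hurwitz_out : forall k, ~~ (i <= k <= n) -> phi k = gen k;
  hurwitz_prod : subst phi (zword i n) =w zword i n }.

Lemma hurwitz_reduced i n phi : hurwitz i n phi -> forall k, wred (phi k).
Proof. by move=> h k; case: (hurwitz_conj h k). Qed.

Lemma hurwitz_sgen i n phi x : hurwitz i n phi -> i <= x.1 < n ->
  hurwitz i n (acomp (sgen x) phi).
Proof.
case: x => j b h /= hx; split=> [k|k hk|].
- by have [w [a e]] := sgen_cform (j, b) k; rewrite /acomp e; apply: is_conj_ext (hurwitz_conj h a).
- by rewrite /acomp sgen_out /=; [rewrite ext_gen (hurwitz_out h) // reduce_id|lia|lia].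
- by rewrite subst_acomp sgen_zword // (hurwitz_prod h).
Qed.

Lemma acomp_sgenK x phi : (forall k, wred (phi k)) ->
  phi =1 acomp (sgen x) (acomp (sgen (linv x)) phi).
Proof.
move=> r k; rewrite -acompA (eq_acomp (sgen_inv x) (g' := phi)) //.
by rewrite acomp_idl.
Qed.

Lemma hurwitz_next i n phi : hurwitz i n phi -> i <= n -> phi i = gen i ->
  hurwitz i.+1 n phi.
Proof.
move=> h hi e; split=> [k|k hk|]; first exact: hurwitz_conj h k.
  have [->//|nk] := eqVneq k i; apply: (hurwitz_out h); lia.
have := hurwitz_prod h; rewrite zword_cons // subst_cons e => E.
rewrite -(winvKcat (gen i) (subst _ _)) E -[_ :: _]cat1s -/(gen i).
by rewrite winvKcat.
Qed.

(* The middle letter of [g], or that of [h], is cancelled in the product [g ++ h]. *)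
Definition overlap (g h : word) : bool :=
  suffix ((conj_mid g, false) :: conj_tail g) (conj_tail h) ||
  suffix ((conj_mid h, true) :: conj_tail h) (conj_tail g).

Lemma size_conj u : is_conj u -> size u = (size (conj_tail u)).*2.+1.
Proof. by case=> _ e; rewrite {1}e size_cform. Qed.

Lemma size_reduce_eqw u v : u =w v -> size (reduce u) <= size v.
Proof. by case=> ->; apply: size_reduce. Qed.

Lemma acomp_sigmaL i phi : acomp (sgen (i, false)) phi i = reduce (phi i.+1).
Proof. by rewrite /acomp /sgen /= sigmaL ext_gen. Qed.

Lemma acomp_sigmaR i phi :
  acomp (sgen (i, false)) phi i.+1 = reduce (winv (phi i.+1) ++ phi i ++ phi i.+1).
Proof.
by rewrite /acomp /sgen /= sigmaR extE !subst_cat subst_winv !subst_gen.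
Qed.

Lemma acomp_sigma_invL i phi :
  acomp (sgen (i, true)) phi i = reduce (phi i ++ phi i.+1 ++ winv (phi i)).
Proof.
by rewrite /acomp /sgen /= sigma_invL extE !subst_cat subst_winv !subst_gen.
Qed.

Lemma acomp_sigma_invR i phi : acomp (sgen (i, true)) phi i.+1 = reduce (phi i).
Proof. by rewrite /acomp /sgen /= sigma_invR ext_gen. Qed.

Lemma acomp_sgen_out x phi k : k != x.1 -> k != x.1.+1 -> wred (phi k) ->
  acomp (sgen x) phi k = phi k.
Proof. by move=> h1 h2 r; rewrite /acomp sgen_out // ext_gen reduce_id. Qed.

(** Let [g = w^-1 t_a w] and [h = v^-1 t_b v] be the two entries. If [v = s t_a w], then
    [v g^-1 = s w], so the entry [g h g^-1] made by [sigma_k^-1] is shorter than [h]. If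
    [w = s t_b^-1 v], then [w h = s v], and [sigma_k] makes the shorter entry [h^-1 g h]. *)
Lemma overlap_shorten phi k : (forall j, is_conj (phi j)) ->
  overlap (phi k) (phi k.+1) -> exists b,
  size (acomp (sgen (k, b)) phi k) + size (acomp (sgen (k, b)) phi k.+1)
    < size (phi k) + size (phi k.+1).
Proof.
move=> hc; have [hk ek] := hc k; have [hl el] := hc k.+1.
rewrite (size_conj (hc k)) (size_conj (hc k.+1)).
set w := conj_tail _ in ek *; set a := conj_mid _ in ek.
set v := conj_tail _ in el *; set b := conj_mid _ in el.
rewrite /overlap -/a -/w -/b -/v; case/orP=> /suffixP[s e].
  exists true; rewrite acomp_sigma_invL acomp_sigma_invR.
  rewrite (reduce_id hk) ek size_cform.
  suff /size_reduce_eqw : cform w a ++ phi k.+1 ++ winv (cform w a) =w cform (s ++ w) b.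
    by rewrite size_cform e !size_cat /=; lia.
  rewrite el e !cformE !winv_cat winvK -[_ :: w]cat1s -/(gen a) !winv_cat -!catA.
  by rewrite !(winvKcat, catKwinv).
exists false; rewrite acomp_sigmaL acomp_sigmaR.
rewrite (reduce_id hl) el size_cform.
suff /size_reduce_eqw : winv (cform v b) ++ phi k ++ cform v b =w cform (s ++ v) a.
  by rewrite size_cform e !size_cat /=; lia.
rewrite ek e !cformE !winv_cat winvK -[_ :: v]cat1s -[[:: (b, true)]]/(winv (gen b)).
rewrite !winv_cat winvK -!catA.
by rewrite !(winvKcat, catKwinv).
Qed.

Lemma sum_lt2 (f g : nat -> nat) i j n : i <= j < n ->
    (forall k, k != j -> k != j.+1 -> f k = g k) -> f j + f j.+1 < g j + g j.+1 ->
  \sum_(i <= k < n.+1) f k < \sum_(i <= k < n.+1) g k.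
Proof.
move=> /andP[hi hj] e lt.
have h0 : j <= n.+1 by lia.
have h1 : j < n.+1 by lia.
have h2 : j.+1 < n.+1 by lia.
rewrite !(big_cat_nat hi h0) /= !(big_ltn h1) !(big_ltn h2).
rewrite (eq_big_nat _ _ (F2 := g)); last by move=> k hk; apply: e; lia.
rewrite [\sum_(j.+2 <= k < _) f k](eq_big_nat _ _ (F2 := g)); last by move=> k hk; apply: e; lia.
lia.
Qed.

(** Induction on the total length of the entries [i+1, ..., n], which [overlap_shorten] lowers as
    long as two neighbours overlap; moves of index above [i] leave entry [i] alone. *)
Lemma hurwitz_minimise i n phi : hurwitz i n phi -> exists l psi,
  [/\ hurwitz i n psi, all (fun x => i < x.1 < n) l, phi =1 acomp (sprod l) psi,
      psi i = phi i & forall k, i < k < n -> ~~ overlap (psi k) (psi k.+1)].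
Proof.
have [m] := ubnP (\sum_(i.+1 <= k < n.+1) size (phi k)).
elim: m phi => // m IH phi ltm h.
have [/hasP[k]|] := boolP (has (fun k => overlap (phi k) (phi k.+1)) (iota i.+1 (n - i.+1))).
  rewrite mem_iota => hk /(overlap_shorten (hurwitz_conj h))[b hb].
  have hkn : i.+1 <= k < n by lia.
  set phi' := acomp (sgen (k, b)) phi in hb.
  have out j : j != k -> j != k.+1 -> phi' j = phi j.
    by move=> h1 h2; apply: acomp_sgen_out => //; apply: hurwitz_reduced h j.
  have h' : hurwitz i n phi' by apply: hurwitz_sgen => //=; lia.
  have [|l [psi [h1 h2 h3 h4 h5]]] := IH phi' _ h'.
    suff : \sum_(i.+1 <= k < n.+1) size (phi' k) < \sum_(i.+1 <= k < n.+1) size (phi k) by lia.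
    by apply: (@sum_lt2 _ _ _ k) => // j n1 n2; rewrite out.
  (* The move [(k, b)] led from [phi] to [phi'], so its inverse leads back. *)
  exists ((k, ~~ b) :: l), psi; split=> //=.
  - by rewrite h2 andbT; lia.
  - move=> j; rewrite (acomp_sgenK (k, ~~ b) (hurwitz_reduced h)) /= acompA.
    by apply: eq_acomp => // q; rewrite -h3 /phi' /linv /= negbK.
  - by rewrite h4 out //; lia.
move/hasPn => no; exists [::], phi; split=> // [j|k hk].
  by rewrite acomp_idl //; apply: hurwitz_reduced h.
by apply: no; rewrite mem_iota; lia.
Qed.

(** * The reduced form of a minimal tail *)

Lemma wred_catl s t : wred (s ++ t) -> wred s.
Proof. by move/cat_sorted2 => []. Qed.

Lemma wred_catr s t : wred (s ++ t) -> wred t.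
Proof. by move/cat_sorted2 => []. Qed.

Lemma cancel_split w z : wred w -> wred z ->
  exists u s t, [/\ w = u ++ s, z = winv s ++ t & wred (u ++ t)].
Proof.
elim: w => [|x w IH] rw rz; first by exists [::], [::], z.
have [u [s [t [ew ez r]]]] := IH (path_sorted rw) rz.
case: u ew r => [|c u] ew r /=; last first.
  exists (x :: c :: u), s, t; split=> //=; first by rewrite ew.
  by move: rw; rewrite ew /wred /= in r * => /andP[-> _].
case: t ez r => [|d t] ez r; first by exists [:: x], s, [::]; rewrite ew.
have [ed|nd] := eqVneq d (linv x).
  exists [::], (x :: s), t; split; rewrite ?ew //; last exact: path_sorted r.
  by rewrite winv_cons -catA /= -ed.
by exists [:: x], s, (d :: t); rewrite ew; split=> //=; rewrite nd.
Qed.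

(** Write the tails of [g] and [h] as [w = u s] and [v = t^-1 s] with [u t] reduced, and let [t_a],
    [t_b] be the middle letters. If [t_a] cancels, then [u] is empty and [t_a w] is a suffix of [v];
    if [t_b] cancels, then [t] is empty and [t_b^-1 v] is a suffix of [w]. With [u] and [t] both
    empty two positive letters meet. *)
Lemma no_overlap_reduced g h : is_conj g -> is_conj h -> ~~ overlap g h ->
  wred ((conj_mid g, false) :: reduce (conj_tail g ++ winv (conj_tail h))
          ++ [:: (conj_mid h, false)]).
Proof.
case=> rg eg [rh eh]; rewrite /overlap negb_or.
set w := conj_tail g in eg *; set a := conj_mid g in eg *.
set v := conj_tail h in eh *; set b := conj_mid h in eh *.
case/andP=> no1 no2.
move: rg rh; rewrite eg eh !wred_cform => /andP[_ rw] /andP[rv _].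
have rv' : wred (rcons (winv v) (b, false)).
  by rewrite -wred_winv -cats1 winv_cat winvK.
have [u [s [t [ew ez r]]]] : exists u s t, [/\ w = u ++ s, winv v = winv s ++ t & wred (u ++ t)].
  by apply: cancel_split; [apply: path_sorted rw | rewrite wred_winv; apply: path_sorted rv].
have ev : v = winv t ++ s by rewrite -(winvK v) ez winv_cat winvK.
have -> : reduce (w ++ winv v) = u ++ t.
  apply: eqw_reduced => //; first exact: wred_reduce.
  by rewrite reduce_eqw ew ez -catA catKwinv.
have rt : wred (t ++ [:: (b, false)]).
  by move: rv'; rewrite ez -cats1 -catA; apply: wred_catr.
have ru : wred ((a, false) :: u) by move: rw; rewrite ew -cat_cons; apply: wred_catl.
case: t => [|d t] in ez r ev rt *.
  rewrite cats0; case: (lastP u) ew r ru => [|u' c] ew r ru.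
    by rewrite /wred /= xpair_eqE andbF.
  rewrite cat_rcons -cat_cons wred_cat_cons rcons_cons ru /wred /= andbT.
  apply: contra no2 => /eqP ec.
  have ec' : c = (b, true) by rewrite -(linvK c) -ec.
  by apply/suffixP; exists u'; rewrite ew cat_rcons ev ec'.
rewrite -catA -!cat_cons wred_cat_cons rt andbT.
case: u => [|c u] in ew r ru *.
  rewrite /wred /= andbT; apply: contra no1 => /eqP ed.
  by apply/suffixP; exists (winv t); rewrite ev ew winv_cons ed linvK -catA.
have := r; rewrite wred_cat_cons => /andP[r1 _].
by move: ru r1; rewrite /wred /= => /andP[-> _].
Qed.

(* For a tail without overlaps this is the part of the reduced product of
   [phi j, ..., phi (j + m)] that precedes the middle letter of [phi (j + m)]. *)
Fixpoint chain (phi : endo) j m : word :=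
  if m is m'.+1 then
    chain phi j m' ++ (conj_mid (phi (j + m')), false) ::
      reduce (conj_tail (phi (j + m')) ++ winv (conj_tail (phi (j + m'.+1))))
  else winv (conj_tail (phi j)).

Lemma chain_prod phi j m : (forall k, is_conj (phi k)) ->
  chain phi j m ++ conj_tail (phi (j + m)) =w subst phi (seg j m).
Proof.
move=> hc; elim: m => [|m IH] /=; first by rewrite addn0 winv_cat_id.
rewrite segS subst_cat -IH subst_gen [in X in _ =w _ ++ X](hc (j + m)).2 cformE.
rewrite reduce_eqw -cat1s -!catA winv_cat_id cats0.
by rewrite catKwinv.
Qed.

(** Successive pieces from [no_overlap_reduced] share a middle letter, and [wred_cat_cons] glues
    reduced words along a common letter. *)
Lemma chain_reduced phi j m : (forall k, is_conj (phi k)) ->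
    (forall k, j <= k < j + m -> ~~ overlap (phi k) (phi k.+1)) ->
  wred (chain phi j m ++ (conj_mid (phi (j + m)), false) :: conj_tail (phi (j + m))).
Proof.
move=> hc; elim: m => [|m IH] no /=.
  by rewrite addn0; have [r e] := hc j; rewrite {1}e in r.
have {}/IH IH : forall k, j <= k < j + m -> ~~ overlap (phi k) (phi k.+1).
  by move=> k hk; apply: no; lia.
have rm := no_overlap_reduced (hc (j + m)) (hc (j + m).+1) (no _ _).
rewrite -catA /= wred_cat_cons.
move: IH; rewrite wred_cat_cons => /andP[-> _]; rewrite andTb.
rewrite -cat_cons wred_cat_cons addnS -cats1 cat_cons rm; last lia.
have [r e] := hc (j + m).+1; move: r; rewrite e wred_cform => /andP[_] /=.
by rewrite -e.
Qed.

Lemma chain_prefix phi j m d : exists Q, forall s,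
  chain phi j (m + d) ++ (conj_mid (phi (j + (m + d))), false) :: s =
  chain phi j m ++ (conj_mid (phi (j + m)), false) :: Q s.
Proof.
elim: d => [|d [Q IH]]; first by exists id; rewrite addn0.
eexists => s; rewrite addnS /= -catA /= IH; reflexivity.
Qed.

Lemma wred_size_le u v : wred u -> u =w v -> size u <= size v.
Proof. by move=> r /size_reduce_eqw; rewrite reduce_id. Qed.

(** The triangle inequalities for the word length of [w v^-1]. *)
Lemma size_reduce_winv w v : wred w -> wred v ->
  let u := size (reduce (w ++ winv v)) in
  [/\ size w <= u + size v, size v <= u + size w & u <= size w + size v].
Proof.
move=> rw rv /=; split.
- rewrite -size_cat; apply: wred_size_le => //.
  by rewrite reduce_eqw -catA winv_cat_id cats0.
- rewrite addnC -(size_winv v) -(size_winv w) -size_cat.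
  apply: wred_size_le; first by rewrite wred_winv.
  by rewrite reduce_eqw winvKcat.
- by rewrite -(size_winv v) -size_cat size_reduce.
Qed.

Lemma wred_conj_tail u : is_conj u -> wred (conj_tail u).
Proof. by case=> r e; move: r; rewrite {1}e => /wred_catr/path_sorted. Qed.

(** [R] is the reduced tail product and [P k] its prefix before the middle letter of [phi k], so
    [size (P k)] is the position of that letter. The length bounds follow from [size_reduce_winv],
    each further entry contributing at least its middle letter. *)
Lemma chain_decomp i n phi : (forall k, is_conj (phi k)) -> i < n ->
    (forall k, i < k < n -> ~~ overlap (phi k) (phi k.+1)) ->
  exists (R : word) (P : nat -> word),
  [/\ wred R /\ size R = (size (P n)).+1 + size (conj_tail (phi n)),
      R =w subst phi (zword i.+1 n), P i.+1 = winv (conj_tail (phi i.+1)),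
      forall k, i < k < n -> size (P k) < size (P k.+1) <=
        (size (P k)).+1 + size (conj_tail (phi k)) + size (conj_tail (phi k.+1)) &
      forall k, i < k <= n ->
      [/\ exists Q, R = P k ++ (conj_mid (phi k), false) :: Q,
          P k ++ conj_tail (phi k) =w subst phi (seg i.+1 (k - i.+1)),
          size (conj_tail (phi k)) + (k - i.+1) <= size (P k) &
          (size (P k)).+1 + size (conj_tail (phi k)) + (n - k) <= size R]].
Proof.
move=> hc lt_in no; set j := i.+1; set P := fun k => chain phi j (k - j).
pose N := n - j; have eN : j + N = n by lia.
pose R := P n ++ (conj_mid (phi n), false) :: conj_tail (phi n).
have hu k := size_reduce_winv (wred_conj_tail (hc k)) (wred_conj_tail (hc k.+1)).
have PS k : i < k -> size (P k.+1) = (size (P k)).+1 +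
    size (reduce (conj_tail (phi k) ++ winv (conj_tail (phi k.+1)))).
  move=> hk; rewrite /P subSn //= size_cat /= addnS.
  by rewrite addnS subnKC.
exists R, P; split.
- split; last by rewrite size_cat addnS.
  rewrite /R /P -/N -eN; apply: chain_reduced => // k hk; apply: no; lia.
- rewrite (_ : zword j n = seg j N ++ gen n); last first.
    by rewrite -{2}eN -segS /zword; congr seg; lia.
  rewrite subst_cat subst_gen -chain_prod // eN [in X in _ ++ X](hc n).2 cformE.
  by rewrite -!catA catKwinv.
- by rewrite /P subnn.
- by move=> k hk; rewrite PS; [have [] := hu k; lia | lia].
move=> k /andP[hk kn]; split.
- have [Q hQ] := chain_prefix phi j (k - j) (n - k).
  exists (Q (conj_tail (phi n))); rewrite /R /P.
  move: (hQ (conj_tail (phi n))).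
  have -> : k - j + (n - k) = n - j by lia.
  by rewrite !subnKC.
- have := chain_prod j (k - j) hc; by rewrite (_ : j + (k - j) = k); last lia.
- elim: k hk kn => // k IH; rewrite ltnS leq_eqVlt => /orP[/eqP<- _|hk kn].
    by rewrite /P !subnn /= size_winv addn0.
  by have := IH hk (ltnW kn); rewrite PS //; have [] := hu k; lia.
move em: (n - k) => m; elim: m k hk kn em => [|m IH] k hk kn em.
  by have -> : k = n; [lia | rewrite /R size_cat /=; lia].
have := IH k.+1 (ltnW hk); rewrite PS //; have [] := hu k; lia.
Qed.

(** * Shortening the first entry *)

Lemma ohead_cform_rcons w e a : ohead (cform (rcons w e) a) = Some (linv e).
Proof. by rewrite /cform -cats1 winv_cat. Qed.

Lemma size_zword i n : size (zword i n) = n.+1 - i.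
Proof. by rewrite size_map size_iota. Qed.

Lemma zword_pos i n : all (fun x => ~~ x.2) (zword i n).
Proof. by apply/allP => x /mapP[k _ ->]. Qed.

Lemma wred_pos s : all (fun x => ~~ x.2) s -> wred s.
Proof.
case: s => [|x s] // /=; elim: s x => [|y s IH] // x /= /and3P[hx hy hs].
rewrite IH /= ?hy // andbT.
by case: x y hx hy {IH} => a [] [b []] //= _ _; rewrite xpair_eqE andbF.
Qed.

Lemma all_winv (p : bool -> bool) s :
  all (fun x => p x.2) (winv s) = all (fun x => p (~~ x.2)) s.
Proof. by rewrite all_rev all_map; apply: eq_all => -[]. Qed.

Lemma hurwitz_lt i n phi : hurwitz i n phi -> phi i <> gen i -> i < n.
Proof.
move=> h ne; rewrite ltnNge; apply/negP => le; apply: ne.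
have [ein|ne] := eqVneq i n; last by apply: (hurwitz_out h); lia.
have := hurwitz_prod h; rewrite -ein /zword (_ : i.+1 - i = 1); last lia.
rewrite subst_gen => e; apply: eqw_reduced e => //; exact: hurwitz_reduced h i.
Qed.

Lemma hurwitz_tail i n phi : hurwitz i n phi -> i <= n ->
  subst phi (zword i.+1 n) =w winv (phi i) ++ zword i n.
Proof.
move=> h hi; rewrite -(hurwitz_prod h) (zword_cons hi) subst_cons.
by rewrite winvKcat.
Qed.

Lemma cat_size_split (T : Type) (u s v t : seq T) : u ++ s = v ++ t -> size v <= size u ->
  exists r, u = v ++ r /\ t = r ++ s.
Proof.
move=> e le; exists (drop (size v) u).
have e1 : take (size v) u = v.
  by have := congr1 (take (size v)) e; rewrite takel_cat // take_size_cat.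
split; first by rewrite -[in RHS]e1 size_take_min (minn_idPl le) cat_take_drop.
have := congr1 (drop (size v)) e; rewrite [RHS]drop_size_cat // => <-.
rewrite drop_cat; case: ltngtP le => // ->.
by rewrite drop_size subnn drop0.
Qed.

(** With [phi i = w^-1 t_a w] and [w = v t_i^-1], the tail product is [A Z], where
    [A = w^-1 t_a^-1 v] and [Z = t_(i+1) ... t_n]. The cancellation between [A] and [Z] spares
    [w^-1], and comparing lengths bounds the conjugator [w'] of [phi (i+1)] by [w]. Once [w'] is
    strictly shorter, [w'^-1] with the middle letter after it is a prefix of [w^-1]. *)
Lemma neg_step i n phi : hurwitz i n phi -> phi i <> gen i ->
    ohead (phi i) = Some (i, false) ->
    (forall k, i < k < n -> ~~ overlap (phi k) (phi k.+1)) ->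
  ohead (phi i.+1) = Some (i, false) /\ size (phi i.+1) < size (phi i).
Proof.
move=> h ne hd no; have lt_in := hurwitz_lt h ne.
have hc := hurwitz_conj h.
have [R [P [[rR _] eR P1 _ hP]]] := chain_decomp hc lt_in no.
have [|[Q eQ] _ _ sR] := hP i.+1; first by rewrite ltnSn.
have [r e] := hc i; have [r' e'] := hc i.+1.
rewrite (size_conj (hc i)) (size_conj (hc i.+1)).
rewrite hurwitz_tail // in eR; last lia.
rewrite P1 size_winv in eQ sR.
set w := conj_tail (phi i) in e *; set a := conj_mid _ in e.
set w' := conj_tail (phi i.+1) in e' eQ sR *; set a' := conj_mid _ in e' eQ.
have [v ew] : exists v, w = rcons v (i, true).
  case: (lastP w) e => [|v [k b]] e; move: hd ne; rewrite e.
    by case=> ->.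
  by rewrite ohead_cform_rcons => -[-> eb] _; exists v; case: b eb {e}.
pose A := winv w ++ (a, true) :: v; pose Z := zword i.+1 n.
have sA : size A = (size w).*2 by rewrite size_cat size_winv ew /= size_rcons; lia.
have sZ : size Z = n - i by rewrite size_zword.
have rA : wred A.
  move: r; rewrite -wred_winv e /cform winv_cat winv_cons winvK -catA {2}ew -cats1.
  by rewrite (_ : _ ++ _ = A ++ [:: (i, true)]) => [/wred_catl|]; last by rewrite /A -catA.
have eR' : R =w A ++ Z.
  rewrite eR e cformE zword_cons; last lia.
  rewrite !winv_cat winvK {2}ew -cats1 /A -!catA -[_ :: zword _ _]cat1s.
  by rewrite (_ : [:: (i, true)] = winv (gen i)) // winvKcat.
have [u [s [t [eA eZ rut]]]] := cancel_split rA (wred_pos (zword_pos i.+1 n)).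
have {eR'} eR' : R = u ++ t.
  by apply: eqw_reduced => //; rewrite eR' eA [Z]eZ -catA catKwinv.
have sneg : all (fun x => x.2) s.
  have := zword_pos i.+1 n; rewrite eZ all_cat => /andP[+ _].
  by rewrite (all_winv negb) => /sub_all; apply => x; rewrite negbK.
(* The word [s] cancels against the positive word [Z], so it is negative. If it reached into [w^-1],
   then [v], and with it [w], would be negative, and [w^-1] could not share a letter with [s]. *)
have su : size w <= size u.
  rewrite leqNgt; apply/negP => lt.
  have [||s1 [e1 e2]] := @cat_size_split _ (winv w) ((a, true) :: v) u s.
  - by rewrite -eA.
  - by rewrite size_winv ltnW.
  case: s1 e1 e2 => [|c s1] e1 e2.
    by move: lt; rewrite -(size_winv w) e1 cats0 ltnn.
  move: sneg; rewrite e2 all_cat /= => /andP[/andP[hc1 _] hv].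
  have : all (fun x => ~~ x.2) (winv w).
    rewrite (all_winv negb) ew all_rcons /=.
    by apply: sub_all hv => x; rewrite negbK.
  by rewrite e1 all_cat /= hc1 andbF.
have sAu : size u + size s = (size w).*2 by rewrite -sA eA size_cat.
have sZt : size s + size t = n - i by rewrite -sZ [Z]eZ size_cat size_winv.
have sRu : size R = size u + size t by rewrite eR' size_cat.
have lt : size w' < size w.
  rewrite ltn_neqAle; apply/andP; split; last lia.
  (* Equal lengths leave no room for cancellation; position [size w] of [R] would then carry both
     [t_a^-1] and the positive middle letter of [phi (i+1)]. *)
  apply/eqP => eww.
  have s0 : s = [::] by case: (s) sAu sZt => //= *; lia.
  move: eA eR'; rewrite s0 cats0 => <-; rewrite eQ /A -catA cat_cons.
  move/(congr1 (fun z => nth (0, false) z (size w))).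
  by rewrite !nth_cat !size_winv eww ltnn subnn.
split; last lia.
have [u2 [eu _]] : exists r, u = winv w ++ r /\ (a, true) :: v = r ++ s.
  by apply: cat_size_split; rewrite ?size_winv // -eA.
have [||q [eq _]] := @cat_size_split _ (winv w) (u2 ++ t) (rcons (winv w') (a', false)) Q.
- by rewrite catA -eu -eR' eQ cat_rcons.
- by rewrite size_rcons !size_winv.
move: hd; rewrite e' /cform -!cat_rcons e /cform eq -catA.
by case: (winv w').
Qed.

(** Inverse moves of indices [i+d-1, ..., i] carry [phi (i+d)] to the front, conjugating it by the
    entries that it passes. Undoing them contributes the positive letters of [l]. *)
Lemma hurwitz_front i n phi d : hurwitz i n phi -> i + d <= n -> exists l psi,
  [/\ hurwitz i n psi, phi =1 acomp (sprod l) psi,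
      all (fun x => (i <= x.1 < n) && ~~ x.2) l, 0 < d -> (i, false) \in l &
      psi i =w subst phi (seg i d) ++ phi (i + d) ++ winv (subst phi (seg i d))].
Proof.
elim: d phi => [|d IH] phi h hd.
  exists [::], phi; split=> // [k|]; last by rewrite addn0 cats0.
  by rewrite acomp_idl //; apply: hurwitz_reduced h.
set phi' := acomp (sgen (i + d, true)) phi.
have h' : hurwitz i n phi' by apply: hurwitz_sgen => //=; lia.
have [|l [psi [h1 h2 h3 h4 h5]]] := IH phi' h'; first lia.
exists ((i + d, false) :: l), psi; split=> //=.
- move=> k; rewrite (acomp_sgenK (i + d, false) (hurwitz_reduced h)) acompA.
  by apply: eq_acomp => // q; rewrite -h2.
- by rewrite h3 !andbT; lia.
- move=> _; rewrite inE; case: d {IH hd phi' h' h2 h3 h5} h4 => [|d] h4.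
    by rewrite addn0 eqxx.
  by rewrite h4 ?orbT.
have -> : subst phi (seg i d.+1) = subst phi' (seg i d) ++ phi (i + d).
  rewrite segS subst_cat subst_gen; congr (_ ++ _); rewrite /subst /seg -!map_comp.
  congr flatten; apply/eq_in_map => k; rewrite mem_iota /= => hk.
  by rewrite /phi' acomp_sgen_out //=; [lia | lia | apply: hurwitz_reduced h k].
rewrite h5 /phi' acomp_sigma_invL reduce_eqw winv_cat -!catA addnS.
by [].
Qed.

(* Applied when [phi i = w^-1 x w] does not start with [t_i], with [L] the length of [w],
   [p k] the position of the middle letter of [phi k] in the tail product of length [S],
   and [a k] the length of its conjugator. *)
Lemma window_position (p a : nat -> nat) i n L S : i < n -> S = L.*2.+1 + (n.+1 - i) ->
    p i.+1 = a i.+1 -> S = (p n).+1 + a n ->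
    (forall k, i < k < n -> p k.+1 <= (p k).+1 + a k + a k.+1) ->
    (forall k, i < k <= n ->
       [/\ p k <> L, a k + (k - i.+1) <= p k & (p k).+1 + a k + (n - k) <= S]) ->
  exists2 k, i < k <= n & L < p k <= L.*2.+1.
Proof.
move=> lt_in eS p1 pn step hp.
have [/hasP[k]|] := boolP (has (fun k => L < p k <= L.*2.+1) (iota i.+1 (n - i))).
  by rewrite mem_iota => hk hpk; exists k => //; lia.
move/hasPn => no; exfalso.
have {}no k : i < k <= n -> ~~ (L < p k <= L.*2.+1).
  by move=> hk; apply: no; rewrite mem_iota; lia.
(* The window consists of the positions of the factor [w t_i]. The first [p] is below [L], and the
   length bounds forbid jumping from below [L] over the window. So [p n < L], whereas the values at
   [n] force [p n > L]. *)
suff H d : i.+1 + d <= n -> p (i.+1 + d) < L.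
  have := H (n - i.+1); have [] := hp n; rewrite ?lt_in ?leqnn ?subnKC //; lia.
elim: d => [|d IH] hd.
  by rewrite addn0; have := no i.+1; have := hp i.+1; rewrite ltnSn lt_in /= => -[] //; lia.
have [|_ h1 _] := hp (i.+1 + d); first lia.
have [|h2 _ h3] := hp (i.+1 + d).+1; first lia.
have := step (i.+1 + d); have := no (i.+1 + d).+1; have := IH; rewrite addnS; lia.
Qed.

(** Let [x_k] be a middle letter found by [window_position], and split [w = w0 y] so that [x_k] is
    the first letter of [y t_i]. The entries [i, ..., k-1] multiply to [y^-1] times the tail of
    [phi k], so [hurwitz_front] yields the first entry [y^-1 x_k y]. This is [t_i] if [y] is empty,
    and otherwise a leading [x_k] of [y] drops out. *)
Lemma pos_step i n phi : hurwitz i n phi -> ohead (phi i) != Some (i, false) ->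
    (forall k, i < k < n -> ~~ overlap (phi k) (phi k.+1)) ->
  exists l psi,
  [/\ hurwitz i n psi, phi =1 acomp (sprod l) psi,
      all (fun x => (i <= x.1 < n) && ~~ x.2) l, (i, false) \in l &
      psi i = gen i \/ ohead (psi i) != Some (i, false) /\ size (psi i) < size (phi i)].
Proof.
move=> h hd no; have lt_in : i < n.
  by apply: (hurwitz_lt h) => e; rewrite e eqxx in hd.
have hc := hurwitz_conj h.
have [R [P [[rR sR] eR P1 stepP hP]]] := chain_decomp hc lt_in no.
have [r e] := hc i; rewrite (size_conj (hc i)).
rewrite hurwitz_tail // in eR; last lia.
set w := conj_tail (phi i) in e *; set a := conj_mid _ in e.
have ewinv : winv (phi i) = winv w ++ (a, true) :: w.
  by rewrite e /cform winv_cat winv_cons winvK -catA.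
pose Z := zword i.+1 n.
have {eR} eR : R = winv w ++ (a, true) :: w ++ (i, false) :: Z.
  apply: eqw_reduced; rewrite ?eR ?ewinv //; last first.
    by rewrite zword_cons ?(ltnW lt_in) // -catA.
  have rZ : wred ((i, false) :: Z).
    by rewrite /Z -zword_cons ?(ltnW lt_in) //; apply/wred_pos/zword_pos.
  rewrite wred_cat_cons -cat_cons wred_cat_cons rZ.
  have := r; rewrite -wred_winv ewinv wred_cat_cons => /andP[-> _].
  rewrite andTb andbT.
  (* By inversion, the junction of [t_a^-1 w] with [t_i] becomes that of [t_i^-1] with the beginning
     of [phi i], where [hd] excludes cancellation. *)
  have -> : rcons ((a, true) :: w) (i, false) = winv ((i, true) :: rcons (winv w) (a, false)).
    by rewrite winv_cons -!cats1 winv_cat winvK.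
  rewrite wred_winv; move: hd r; rewrite e /cform wred_cat_cons => + /andP[+ _].
  by case: (winv w) => [|c s] /= ne; [rewrite andbT => _ | move=> ->; rewrite andbT].
have sR' : size R = (size w).*2.+1 + (n.+1 - i).
  by rewrite eR size_cat /= size_cat /= size_winv size_zword; lia.
have [||||k hk /andP[lo hi]] := @window_position (fun k => size (P k))
    (fun k => size (conj_tail (phi k))) i n (size w) (size R) lt_in sR'.
- by rewrite P1 size_winv.
- by [].
- by move=> k /stepP /andP[].
(* Position [size w] of [R] carries the negative letter [t_a^-1], while middle letters are
   positive. *)
- move=> k /hP[[Q eQ] _ h1 h2]; split=> // eL.
  have := congr1 (fun z => nth (0, false) z (size w)) eQ; rewrite {1}eR.
  by rewrite !nth_cat eL !size_winv ltnn subnn.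
have [[Q eQ] Pprod _ _] := hP k hk.
pose j := size (P k) - (size w).+1.
have hj : j <= size w by rewrite /j; lia.
pose y := drop j w.
have [eP eX] : P k = winv w ++ (a, true) :: take j w /\
    (conj_mid (phi k), false) :: Q = y ++ (i, false) :: Z.
  have [|| q [e1 e2]] := @cat_size_split _ (P k) ((conj_mid (phi k), false) :: Q)
    (winv w ++ (a, true) :: take j w) (y ++ (i, false) :: Z).
  - by rewrite -eQ eR -catA /= catA cat_take_drop.
  - by rewrite size_cat /= size_winv size_takel // /j; lia.
  suff q0 : q = [::] by rewrite e1 e2 q0 cats0.
  apply: size0nil; move: (congr1 size e1).
  by rewrite !size_cat /= size_winv size_takel // /j; lia.
have [l [psi [h1 h2 h3 h4 h5]]] := @hurwitz_front i n phi (k - i) h ltac:(lia).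
rewrite subnKC in h5; last lia.
have {}h5 : psi i =w cform y (conj_mid (phi k)).
  have E : subst phi (seg i (k - i)) =w winv y ++ conj_tail (phi k).
    rewrite (_ : k - i = (k - i.+1).+1); last lia.
    rewrite /seg /= -/(seg _ _) subst_cons -Pprod.
    have -> : P k =w winv (phi i) ++ winv y.
      rewrite eP ewinv -{4}(cat_take_drop j w) -/y -!catA /= -catA.
      by rewrite cat_winv cats0.
    by rewrite -!catA catKwinv.
  rewrite h5 E [in X in X ++ winv _](hc k).2 !cformE winv_cat winvK -!catA.
  by rewrite !catKwinv.
exists l, psi; split=> //; first by apply: h4; lia.
have [ej|nj] := eqVneq j (size w).
  left; apply: eqw_reduced => //; first exact: hurwitz_reduced h1 i.
  move: eX; rewrite h5 /y ej drop_size => -[-> _].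
  by [].
have [y' ey] : exists y', y = (conj_mid (phi k), false) :: y'.
  have sy : size y = size w - j by exact: size_drop.
  by case: (y) sy eX => [|c y'] /= sy; [lia | case=> -> _; exists y'].
have ew : w = take j w ++ (conj_mid (phi k), false) :: y' by rewrite -ey cat_take_drop.
have ry : wred y'.
  by have := wred_conj_tail (hc i); rewrite -/w ew => /wred_catr/path_sorted.
have [s [y2 [ey2 ry2 ec]]] := cform_strip (conj_mid (phi k)) ry.
have epsi : psi i = cform y2 (conj_mid (phi k)).
  apply: eqw_reduced => //; first exact: hurwitz_reduced h1 i.
  rewrite h5 ec ey !cformE winv_cons -[_ :: y']cat1s -/(gen _) -catA.
  by rewrite (_ : [:: linv _] = winv (gen (conj_mid (phi k)))) // winvKcat.
(* [y2] is a suffix of [w]; if it is nonempty, its last letter is that of [w], so [psi i] starts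
   with the same letter as [phi i]. *)
case: (lastP y2) ey2 epsi {ry2 ec} => [|y3 c] ey2 epsi.
  have [ei|ni] := eqVneq (conj_mid (phi k)) i; first by left; rewrite epsi ei.
  right; rewrite epsi /=; split; last lia.
  by apply: contra ni => /eqP[->].
right; rewrite epsi size_cform; move: hd; rewrite e {1}ew ey2 -cat_cons catA -rcons_cat.
rewrite !ohead_cform_rcons => ->; split=> //.
by have := congr1 size ew; rewrite ey2 !size_cat /= size_cat; lia.
Qed.

(** With [b = false] these are the words allowed in a [sigma]-positive product, with [b = true]
    their inverses; that [sigma_j] occurs is stated separately. *)
Definition signed_word (j n : nat) (b : bool) (l : seq (nat * bool)) : bool :=
  all (fun x => (j <= x.1 < n) && ((x.1 == j) ==> (x.2 == b))) l.

Lemma signed_word_cat j n b l1 l2 :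
  signed_word j n b (l1 ++ l2) = signed_word j n b l1 && signed_word j n b l2.
Proof. exact: all_cat. Qed.

Lemma signed_word_gt j n b l : all (fun x => j < x.1 < n) l -> signed_word j n b l.
Proof.
by apply: sub_all => -[k c] /= hk; rewrite (_ : (k == j) = false); lia.
Qed.

(** Whether [phi i] starts with [t_i] decides the sign of the letters of index [i]. The step
    preserves this until [t_i] is reached, so the signs agree throughout the iteration. *)
Lemma hurwitz_step i n phi b : hurwitz i n phi -> phi i <> gen i ->
    (ohead (phi i) == Some (i, false)) = b ->
  exists l psi,
  [/\ hurwitz i n psi, phi =1 acomp (sprod l) psi, signed_word i n b l, (i, b) \in l &
      psi i = gen i \/
      (ohead (psi i) == Some (i, false)) = b /\ size (psi i) < size (phi i)].
Proof.
move=> h ne hb; have [l0 [phi' [h' hl0 e0 ei no]]] := hurwitz_minimise h.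
suff [l [psi [h1 h2 h3 h4 h5]]] : exists l psi,
  [/\ hurwitz i n psi, phi' =1 acomp (sprod l) psi, signed_word i n b l, (i, b) \in l &
      psi i = gen i \/
      (ohead (psi i) == Some (i, false)) = b /\ size (psi i) < size (phi i)].
  exists (l0 ++ l), psi; split=> //; last by rewrite mem_cat h4 orbT.
    move=> k; rewrite e0 (eq_acomp (sprod_cat l0 l) (g' := psi)) // acompA.
    by apply: eq_acomp.
  by rewrite signed_word_cat h3 signed_word_gt.
rewrite -ei in ne hb *; case: b hb => [/eqP hd|/negbT hd].
  have [hd' lt] := neg_step h' ne hd no; have lt_in := hurwitz_lt h' ne.
  exists [:: (i, true)], (acomp (sgen (i, false)) phi'); split=> //.
  - by apply: hurwitz_sgen => //=; rewrite leqnn.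
  - move=> k; rewrite (acomp_sgenK (i, true) (hurwitz_reduced h')).
    apply: eq_acomp => // q; rewrite /sprod /= acomp_idr //; exact: sgen_reduced.
  - by rewrite /signed_word /= leqnn lt_in eqxx.
  - by rewrite inE.
  - right; rewrite acomp_sigmaL reduce_id; last exact: hurwitz_reduced h' _.
    by rewrite hd' eqxx.
have [l [psi [h1 h2 h3 h4 h5]]] := pos_step h' hd no.
exists l, psi; split=> //; last by case: h5 => [|[/negPf-> ?]]; [left | right].
by apply: sub_all h3 => -[k c] /= /andP[-> /negPf->]; rewrite implybT.
Qed.

Lemma hurwitz_reduce i n phi b : hurwitz i n phi -> phi i <> gen i ->
    (ohead (phi i) == Some (i, false)) = b ->
  exists l psi,
  [/\ hurwitz i n psi, phi =1 acomp (sprod l) psi, signed_word i n b l, (i, b) \in l &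
      psi i = gen i].
Proof.
have [m] := ubnP (size (phi i)); elim: m phi => // m IH phi ltm h ne hb.
have [l [psi [h1 h2 h3 h4 [e|[hb' lt]]]]] := hurwitz_step h ne hb.
  by exists l, psi.
have [e|/eqP ne'] := eqVneq (psi i) (gen i); first by exists l, psi.
have [|l' [psi' [k1 k2 k3 k4 k5]]] := IH psi _ h1 ne' hb'; first lia.
exists (l ++ l'), psi'; split=> //; last by rewrite mem_cat h4.
  move=> k; rewrite h2 (eq_acomp (sprod_cat l l') (g' := psi')) // acompA.
  by apply: eq_acomp.
by rewrite signed_word_cat h3 k3.
Qed.

Lemma hurwitz_trichotomy i n phi : hurwitz i n phi ->
  exists2 l, phi =1 sprod l &
    l = [::] \/ exists j b, [/\ i <= j < n, signed_word j n b l & (j, b) \in l].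
Proof.
move em: (n.+1 - i) => m; elim: m i phi em => [|m IH] i phi em h.
  by exists [::]; [move=> k; rewrite (hurwitz_out h) //; lia | left].
have [e|/eqP ne] := eqVneq (phi i) (gen i).
  have le_in : i <= n by lia.
  have [|l hl H] := IH i.+1 phi _ (hurwitz_next h le_in e); first lia.
  exists l => //; case: H => [->|[j [b [hj h1 h2]]]]; [by left | right].
  by exists j, b; split=> //; lia.
have lt_in := hurwitz_lt h ne.
have [l [psi [h1 h2 h3 h4 h5]]] := hurwitz_reduce h ne erefl.
have [|l' hl' H] := IH i.+1 psi _ (hurwitz_next h1 (ltnW lt_in) h5); first lia.
exists (l ++ l').
  by move=> k; rewrite h2 sprod_cat; apply: eq_acomp.
right; exists i, (ohead (phi i) == Some (i, false)); split; rewrite ?leqnn //.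
  (* The word for the later entries has only indices above [i], so its signs do not matter here. *)
  rewrite signed_word_cat h3 /=; case: H => [->//|[j [b [hj hw _]]]].
  apply: signed_word_gt; apply: sub_all hw => -[k c] /= /andP[hk _]; lia.
by rewrite mem_cat h4.
Qed.

(** * Positive words are nontrivial *)

Lemma neq_fst (x y : letter) : x.1 != y.1 -> (x == y) = false.
Proof. by apply: contraNF => /eqP->. Qed.

Lemma linv_neqF (x : letter) : ((x == linv x) = false) * ((linv x == x) = false).
Proof. by split; [|rewrite eq_sym]; apply: negPf (linv_neq x). Qed.

(* The first letters of a reduced word [s] and of the reduced form of its image under
   [A |-> A B A^-1, B |-> A]; both [sigma_inv] and [sigma] have this form, the latter
   with [A = t_(i+1)^-1] and [B = t_i^-1]. *)
Inductive first_shape (A B : letter) : word -> word -> Prop :=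
| ShapeNil : first_shape A B [::] [::]
| ShapeA s q : first_shape A B (A :: s) (A :: B :: q)
| ShapeAV s q : first_shape A B (linv A :: s) (A :: linv B :: q)
| ShapeB s q : ohead q != Some B -> ohead q != Some (linv B) ->
    first_shape A B (B :: s) (A :: q)
| ShapeBV s y q : y \in [:: linv A; B; linv B] -> first_shape A B (linv B :: s) (y :: q)
| ShapeO x s q : x.1 != A.1 -> x.1 != B.1 -> first_shape A B (x :: s) (x :: q).

(** Induction on [s]: each shape records just enough of the image to decide what cancels when the
    image of one more letter is put in front. *)
Lemma first_shapeP (f : endo) A B : A.1 != B.1 ->
    subst f [:: A] = [:: A; B; linv A] -> subst f [:: B] = [:: A] ->
    (forall k, k != A.1 -> k != B.1 -> f k = gen k) ->
  forall s, wred s -> first_shape A B s (ext f s).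
Proof.
move=> nAB fA fB fO.
have nBA : B.1 != A.1 by rewrite eq_sym.
have fAV : subst f [:: linv A] = [:: A; linv B; linv A].
  by rewrite -[[:: linv A]]/(winv [:: A]) subst_winv fA /winv /= /rev /= linvK.
have fBV : subst f [:: linv B] = [:: linv A].
  by rewrite -[[:: linv B]]/(winv [:: B]) subst_winv fB.
have fx x : x.1 != A.1 -> x.1 != B.1 -> subst f [:: x] = [:: x].
  by move=> h1 h2; rewrite /subst /= cats0 fO //; case: x h1 h2 => k [].
have kind x : [\/ x = A, x = linv A, x = B | x = linv B] \/ (x.1 != A.1 /\ x.1 != B.1).
  have two (y z : letter) : y.1 = z.1 -> y = z \/ y = linv z.
    by case: y z => a [] [b []] /= ->; rewrite /linv /=; [left|right|right|left].
  have [/two[]->|h1] := eqVneq x.1 A.1; first by left; constructor 1.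
    by left; constructor 2.
  have [/two[]->|h2] := eqVneq x.1 B.1; first by left; constructor 3.
    by left; constructor 4.
  by right.
have E : (((A == B) = false) * ((B == A) = false) * ((A == linv B) = false) *
    ((linv A == B) = false) * ((linv B == A) = false) * ((B == linv A) = false) *
    ((linv A == linv B) = false) * ((linv B == linv A) = false))%type.
  by do !split; apply: neq_fst.
have EO x : x.1 != A.1 -> x.1 != B.1 ->
    (((A == x) = false) * ((B == x) = false) * ((x == A) = false) * ((x == B) = false) *
    ((linv A == x) = false) * ((linv B == x) = false) *
    ((x == linv A) = false) * ((x == linv B) = false) *
    ((A == linv x) = false) * ((B == linv x) = false) *
    ((linv A == linv x) = false) * ((linv B == linv x) = false))%type.
  by move=> h1 h2; do !split; apply: neq_fst; rewrite //= eq_sym.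
elim=> [|x s IH] r; first exact: ShapeNil.
have -> : ext f (x :: s) = foldr red_push (ext f s) (subst f [:: x]).
  by rewrite (extE _ s) -reduce_cat -subst_cat.
move/path_sorted: (r) => /IH {IH}; move: (ext f s) => t sh.
have {}r : ohead s != Some (linv x) by case: (s) r => //= y s' /andP[].
case: (kind x) => [[] ex|[h1 h2]]; rewrite ?ex in r *;
  rewrite ?fA ?fAV ?fB ?fBV ?(fx x) //;
  case: s t / sh r => [|s q|s q|s q n1 n2|s y q hy|y s q g1 g2] /=;
  rewrite ?(inj_eq Some_inj) ?linvK ?linv_neqF ?E ?eqxx //= ?linvK ?linv_neqF ?E ?eqxx //=.
all: move=> hr.
all: try (move: hy; rewrite !inE => /or3P[] /eqP->).
all: try (case: q n1 n2 => [|z q] /= n1 n2;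
  rewrite ?(inj_eq Some_inj) in n1 n2; rewrite ?linvK ?(negPf n1) ?(negPf n2) /=).
all: rewrite /= ?E ?linv_neqF ?(negPf hr) ?(EO x h1 h2) ?(EO y g1 g2) /=.
all: rewrite ?linvK ?E ?linv_neqF ?(EO x h1 h2) ?(EO y g1 g2) ?eqxx /=.
all: rewrite ?linvK ?E ?linv_neqF ?(EO x h1 h2) ?(EO y g1 g2) ?eqxx /=.
all: by constructor; rewrite //= ?(inj_eq Some_inj) ?inE ?E ?linv_neqF
  ?(EO x h1 h2) ?(EO y g1 g2) ?eqxx ?orbT.
Qed.

(** For [sigma_i^-1] the letter [t_i] is [A] in [first_shape], and an initial [A] is kept; for
    indices above [i] it falls under [ShapeO]. *)
Lemma sgen_ohead i x w : i <= x.1 -> (x.1 == i) ==> x.2 -> wred w ->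
  ohead w = Some (i, false) -> ohead (ext (sgen x) w) = Some (i, false).
Proof.
case: x => j b /= le_ij himp rw hw.
have njj : (j.+1 == j) = false by lia.
have out c k : k != j -> k != j.+1 -> sgen (j, c) k = gen k by exact: (@sgen_out (j, c)).
case: b himp => himp.
  have sh : first_shape (j, false) (j.+1, false) w (ext (sgen (j, true)) w).
    apply: first_shapeP => //=; rewrite ?(eq_sym j) ?njj //.
    - by rewrite /subst /= /sgen /= sigma_invL.
    - by rewrite /subst /= /sgen /= sigma_invR.
    - exact: out.
  by case: w _ / sh {rw} hw => //= s q _ _ [] ; lia.
have sh : first_shape (j.+1, true) (j, true) w (ext (sgen (j, false)) w).
  apply: first_shapeP => //=; rewrite ?njj //.
  - by rewrite /subst /= /sgen /= sigmaR.
  - by rewrite /subst /= /sgen /= sigmaL.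
  - by move=> k h1 h2; apply: out.
move: himp; rewrite implybF => nji.
by case: w _ / sh {rw} hw => //= [s q [] | s y q _ []] //; lia.
Qed.

Lemma sgen_extK x w : wred w -> ext (sgen (linv x)) (ext (sgen x) w) = w.
Proof. by move=> r; rewrite -ext_acomp (eq_ext _ (sgen_inv x)) ext_id. Qed.

(** No step can produce [t_i]: its preimage under [sigma_i^-1] is [t_(i+1)], which does not start
    with [t_i], and under [sigma_k^{+-1}], [k > i], it is [t_i] itself. *)
Lemma negative_ohead i n l w : signed_word i n true l -> wred w ->
    ohead w = Some (i, false) -> w <> gen i ->
  ext (sprod l) w <> gen i.
Proof.
elim: l w => [|[j b] l IH] w /=; first by move=> _ rw _; rewrite ext_id.
case/andP=> /andP[/andP[le_ij _] himp] hl rw hw ne.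
rewrite ext_acomp; apply: IH => //; first exact: ext_reduced.
  by apply: sgen_ohead => //=; rewrite -[b]eqb_id.
move=> e; have := sgen_extK (j, b) rw; rewrite e ext_gen reduce_id ?sgen_reduced //.
have [eji|nji] := eqVneq j i.
  move: himp; rewrite eji eqxx /= => /eqP-> E.
  by move: hw; rewrite -E /sgen /= sigmaL => -[]; lia.
by rewrite sgen_out /=; [move=> E; apply: ne | lia | lia].
Qed.

(** The letters before the first [sigma_i^-1] fix [t_i]; that letter sends it to
    [t_i t_(i+1) t_i^-1], where [negative_ohead] takes over. *)
Lemma negative_nontrivial i n l : signed_word i n true l -> (i, true) \in l ->
  sprod l i <> gen i.
Proof.
elim: l => [|[j b] l IH] //= /andP[/andP[/andP[le_ij _] himp] hl].
rewrite inE /acomp; have [eji _|nji] := eqVneq j i.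
  have r := sgen_reduced (i, true) i; move: himp; rewrite eji eqxx /= => /eqP->.
  by apply: (negative_ohead hl) => //; rewrite /sgen /= sigma_invL.
rewrite xpair_eqE eq_sym (negPf nji) /= => /(IH hl).
rewrite sgen_out /=; [|lia|lia].
by rewrite ext_gen reduce_id ?sprod_reduced.
Qed.

Lemma signed_word_inv j n b l : signed_word j n b l -> signed_word j n (~~ b) (winv l).
Proof.
by rewrite /signed_word all_rev all_map; apply: sub_all => -[k []] /=; case: b.
Qed.

Lemma mem_winv (x : letter) l : (linv x \in winv l) = (x \in l).
Proof. by rewrite mem_rev (mem_map (can_inj linvK)). Qed.

Lemma sprod_inv l : acomp (sprod l) (sprod (winv l)) =1 idE.
Proof.
elim: l => [|x l IH] k; first by rewrite acomp_idl.
rewrite winv_cons (eq_acomp (frefl _) (sprod_cat _ _)) /= acompA -(sgen_inv x).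
apply: eq_acomp => // {}k; rewrite -acompA (eq_acomp IH (frefl _)).
rewrite acomp_idl; last by move=> q; apply: ext_reduced.
by apply: acomp_idr => {}k; apply: sgen_reduced.
Qed.

Lemma positive_nontrivial i n l : signed_word i n false l -> (i, false) \in l ->
  ~ sprod l =1 idE.
Proof.
move=> hl hi e; apply: (negative_nontrivial (signed_word_inv hl) (i := i)).
  by rewrite (mem_winv (i, false)).
rewrite -[RHS](sprod_inv l) (eq_acomp e (frefl _)) acomp_idl //.
exact: sprod_reduced.
Qed.

(** * Braid words as elements of [B_n] *)

Definition letters_le (n : nat) (w : word) : bool := all (fun x => 0 < x.1 <= n) w.

Lemma in_FE n w : in_F n w = wred w && letters_le n w.
Proof. by congr (_ && _); apply/eqP/wredP. Qed.

Lemma letters_reduce n w : letters_le n w -> letters_le n (reduce w).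
Proof.
elim: w => //= x w IH /andP[hx /IH].
by case: (reduce w) => [|y t] /=; rewrite ?hx //; case: ifP => _ /= /andP[hy ->]; rewrite ?hx ?hy.
Qed.

Lemma letters_winv n w : letters_le n (winv w) = letters_le n w.
Proof. by rewrite /letters_le all_rev all_map; apply: eq_all => -[]. Qed.

Lemma letters_cat n u v : letters_le n (u ++ v) = letters_le n u && letters_le n v.
Proof. exact: all_cat. Qed.

Lemma letters_ext n f w : (forall k, 0 < k <= n -> letters_le n (f k)) ->
  letters_le n w -> letters_le n (ext f w).
Proof.
move=> hf hw; apply: letters_reduce; elim: w hw => //= -[k b] w IH /= /andP[hk hw].
by rewrite letters_cat IH // andbT; case: b; rewrite ?letters_winv hf.
Qed.

Lemma in_F_ext n f w : (forall k, 0 < k <= n -> in_F n (f k)) ->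
  in_F n w -> in_F n (ext f w).
Proof.
move=> hf; rewrite !in_FE ext_reduced => /andP[_ hw]; apply: letters_ext => // k /hf.
by rewrite in_FE => /andP[].
Qed.

Definition braid_word (n : nat) (l : seq (nat * bool)) : bool :=
  all (fun x => 0 < x.1 < n) l.

Lemma in_F_sgen n x k : 0 < x.1 < n -> 0 < k <= n -> in_F n (sgen x k).
Proof.
rewrite in_FE sgen_reduced; case: x => i b /= hi hk.
have [->|ni] := eqVneq k i; last have [->|nj] := eqVneq k i.+1.
- case: b; rewrite /sgen /= ?sigma_invL ?sigmaL /=; lia.
- case: b; rewrite /sgen /= ?sigma_invR ?sigmaR /=; lia.
- by rewrite sgen_out //= andbT.
Qed.

Lemma in_F_sprod n l k : braid_word n l -> 0 < k <= n -> in_F n (sprod l k).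
Proof.
elim: l k => [|x l IH] k /=; first by rewrite in_FE /= andbT.
case/andP=> hx hl hk; apply: in_F_ext; last exact: in_F_sgen.
by move=> q hq; apply: IH.
Qed.

Lemma braid_word_inv n l : braid_word n (winv l) = braid_word n l.
Proof. by rewrite /braid_word all_rev all_map; apply: eq_all => -[]. Qed.

Lemma ext_sprodK l w : wred w -> ext (sprod (winv l)) (ext (sprod l) w) = w.
Proof. by move=> r; rewrite -ext_acomp (eq_ext _ (sprod_inv l)) ext_id. Qed.

Lemma is_aut_sprod n l : braid_word n l -> is_aut n (sprod l).
Proof.
move=> hl; split; first by move=> k; apply: in_F_sprod.
split=> [u v|v]; rewrite !in_FE => /andP[ru hu].
  by move=> /andP[rv _] e; rewrite -(ext_sprodK l ru) e ext_sprodK.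
exists (ext (sprod (winv l)) v).
  apply: in_F_ext; last by rewrite in_FE ru.
  by move=> k; apply: in_F_sprod; rewrite braid_word_inv.
by rewrite -{1}(winvK l) ext_sprodK.
Qed.

Lemma sprod_zword n l : braid_word n l -> subst (sprod l) (zword 1 n) =w zword 1 n.
Proof.
elim: l => [|x l IH] /=; first by rewrite subst_id.
by case/andP=> hx hl; rewrite subst_acomp sgen_zword // IH.
Qed.

Lemma z1E n : z1 n = winv (zword 1 n).
Proof. by rewrite /z1 /zword subn1. Qed.

Definition permutes_gens (n : nat) (f : endo) : Prop :=
  exists s : {perm 'I_n}, forall k : 'I_n, conjF n (f k.+1) (gen (s k).+1).

Lemma permutes_gens_acomp n f g : (forall k, 0 < k <= n -> in_F n (g k)) ->
  permutes_gens n f -> permutes_gens n g -> permutes_gens n (acomp f g).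
Proof.
move=> hg [s hs] [t ht]; exists (s * t)%g => k; rewrite permM /acomp.
have [w hw ->] := hs k; have [v hv e] := ht (s k).
exists (reduce (v ++ ext g w)).
  rewrite in_FE wred_reduce letters_reduce // letters_cat.
  have := in_F_ext hg hw; move: hv; rewrite !in_FE => /andP[_ ->] /andP[_ ->] //.
rewrite extE; apply/eqwP.
rewrite subst_reduce !subst_cat subst_winv subst_gen e !reduce_eqw ext_eqw winv_cat.
by rewrite -!catA.
Qed.

Lemma permutes_gens_sgen n x : 0 < x.1 < n -> permutes_gens n (sgen x).
Proof.
case: x => i b /= hi.
have h1 : i.-1 < n by lia.
have h2 : i < n by lia.
(* ['I_n] counts from zero, so [t_i] and [t_(i+1)] have the indices [i - 1] and [i]. *)
exists (tperm (Ordinal h1) (Ordinal h2)) => k.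
case: tpermP => [->|->|/eqP n1 /eqP n2].
- rewrite /= prednK; last lia.
  case: b; rewrite /sgen /= ?sigma_invL ?sigmaL.
    exists (winv (gen i)); first by rewrite in_FE /=; lia.
    by rewrite winvK -sigma_invL (reduce_id (@sgen_reduced (i, true) i)).
  by exists [::].
- rewrite /= prednK; last lia.
  case: b; rewrite /sgen /= ?sigma_invR ?sigmaR; first by exists [::].
  exists (gen i.+1); first by rewrite in_FE /=; lia.
  by rewrite -sigmaR (reduce_id (@sgen_reduced (i, false) i.+1)).
exists [::] => //.
rewrite sgen_out //=.
by apply: contraNneq n1 => e; apply/eqP/val_inj; rewrite /= -e.
Qed.

Lemma permutes_gens_sprod n l : braid_word n l -> permutes_gens n (sprod l).
Proof.
elim: l => [|x l IH] /=.
  by move=> _; exists 1%g => k; exists [::]; rewrite // perm1.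
case/andP=> hx hl; apply: permutes_gens_acomp; last exact: IH.
  by move=> k; apply: in_F_sprod.
exact: permutes_gens_sgen.
Qed.

Lemma inB_sprod n l : braid_word n l -> inB n (sprod l).
Proof.
move=> hl; split; first exact: is_aut_sprod.
split; last exact: permutes_gens_sprod.
rewrite z1E extE; apply: eqw_reduced; first exact: wred_reduce.
  by rewrite wred_winv; apply/wred_pos/zword_pos.
by rewrite reduce_eqw subst_winv sprod_zword.
Qed.

(** * Trichotomy and closure under products *)

Lemma ext_eq_on n (f g : endo) w : (forall k, 0 < k <= n -> f k = g k) ->
  letters_le n w -> ext f w = ext g w.
Proof.
move=> e hw; rewrite /ext; congr (reduce (flatten _)); apply/eq_in_map => x xw.
by rewrite e //; apply: (allP hw).
Qed.

(** Membership in [B_n] constrains only the images of [t_1, ..., t_n], so the other values are reset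
    to those of the identity. *)
Lemma inB_hurwitz n phi : inB n phi ->
  hurwitz 1 n (fun k => if 0 < k <= n then phi k else gen k).
Proof.
move=> [_ [hz [s hs]]]; set phi' := fun k => _; split.
- move=> k; rewrite /phi'; case: ifP => hk; last exact: is_conj_gen.
  have hk' : k.-1 < n by lia.
  have [w hw] := hs (Ordinal hk'); rewrite /= prednK; last lia.
  have [_ [w' [_ r e]]] := cform_strip (s (Ordinal hk')).+1 (wred_reduce w).
  move=> ->; rewrite -cformE.
  suff -> : reduce (cform w (s (Ordinal hk')).+1) = cform w' (s (Ordinal hk')).+1.
    exact: is_conjP.
  apply: eqw_reduced => //; first exact: wred_reduce.
  by rewrite reduce_eqw e !cformE !reduce_eqw.
- by move=> k hk; rewrite /phi' (negPf hk).
have hl : letters_le n (winv (zword 1 n)).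
  by rewrite letters_winv; apply/allP => x /mapP[k]; rewrite mem_iota => hk -> /=; lia.
have E : ext phi' (z1 n) = z1 n.
  by rewrite -[RHS]hz z1E; apply: (@ext_eq_on n) => // k hk; rewrite /phi' hk.
rewrite -[zword 1 n in X in _ =w X]winvK -z1E -E ext_eqw z1E subst_winv.
by rewrite winvK.
Qed.

Lemma sigma_pos_signed n phi : sigma_pos n phi <->
  exists i l, [/\ 0 < i < n, signed_word i n false l, (i, false) \in l &
                  aut_eq n phi (sprod l)].
Proof.
split=> [[n2 [i [hi [l [hl il e]]]]]|[i [l [hi hl il e]]]].
  exists i, l; split=> //; first lia.
  by apply: sub_all hl => -[k b] /= /andP[hk hb]; case: b hb; lia.
split; first lia; exists i; split; first lia; exists l; split=> //.
by apply: sub_all hl => -[k b] /= /andP[hk hb]; case: b hb; lia.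
Qed.

Lemma signed_braid i n b l : 0 < i -> signed_word i n b l -> braid_word n l.
Proof. by move=> hi; apply: sub_all => -[k c] /= /andP[hk _]; lia. Qed.

Lemma sprod_out n l k : braid_word n l -> ~~ (0 < k <= n) -> sprod l k = gen k.
Proof.
elim: l => [|[j b] l IH] //= /andP[hx hl] hk; rewrite /acomp sgen_out /=; [|lia|lia].
by rewrite ext_gen IH // reduce_id.
Qed.

Lemma sigma_pos_nontrivial n phi : sigma_pos n phi -> ~ aut_eq n phi idE.
Proof.
case/sigma_pos_signed => i [l [hi hl il e]] e1.
apply: (positive_nontrivial hl il) => k.
have [hk|hk] := boolP (0 < k <= n); first by rewrite -e // e1.
by apply: (@sprod_out n) => //; apply: signed_braid hl; lia.
Qed.

(** If the two indices differ, the factor with the larger one has no letter of the smaller index, so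
    the concatenation is positive for the minimum. *)
Lemma sigma_pos_acomp n phi psi :
  sigma_pos n phi -> sigma_pos n psi -> sigma_pos n (acomp phi psi).
Proof.
case/sigma_pos_signed => i [l [hi hl il e]] /sigma_pos_signed[j [m [hj hm jm e']]].
apply/sigma_pos_signed; exists (minn i j), (l ++ m).
have widen a b (w : seq (nat * bool)) : b <= a -> signed_word a n false w ->
    signed_word b n false w.
  by move=> le_ba; apply: sub_all => -[k c] /= /andP[hk hc]; case: c hc; lia.
split; first lia.
- by rewrite signed_word_cat (widen _ _ _ (geq_minl i j) hl) (widen _ _ _ (geq_minr i j) hm).
- by rewrite mem_cat /minn; case: ifP => _; rewrite ?il ?jm ?orbT.
move=> k hk; rewrite sprod_cat /acomp e //; apply: (@ext_eq_on n) => //.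
have : in_F n (sprod l k) by apply: in_F_sprod => //; apply: signed_braid hl; lia.
by rewrite in_FE => /andP[].
Qed.

Theorem theorem6p7 (n : nat) (hn : 1 <= n) :
  (forall phi : endo, inB n phi ->
     let A := aut_eq n phi idE in
     let B := sigma_pos n phi in
     let C := exists2 psi : endo, inB n psi /\ aut_eq n (acomp phi psi) idE & sigma_pos n psi in
     [/\ A \/ B \/ C, ~ (A /\ B), ~ (A /\ C) & ~ (B /\ C)]) /\
  (forall phi psi : endo, sigma_pos n phi -> sigma_pos n psi -> sigma_pos n (acomp phi psi)).
Proof.
split; last exact: sigma_pos_acomp.
move=> phi hphi A B C; split.
- have [l hl H] := hurwitz_trichotomy (inB_hurwitz hphi).
  have e : aut_eq n phi (sprod l) by move=> k hk; rewrite -hl hk.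
  case: H => [l0|[j [[] [hj hw hjl]]]]; first by left; move: e; rewrite l0.
    have hb : braid_word n (winv l).
      by rewrite braid_word_inv; apply: signed_braid hw; lia.
    right; right; exists (sprod (winv l)).
      split; first exact: inB_sprod.
      by move=> k hk; rewrite /acomp e //; apply: sprod_inv.
    apply/sigma_pos_signed; exists j, (winv l); split=> //.
      exact: signed_word_inv hw.
    by rewrite (mem_winv (j, true)).
  by right; left; apply/sigma_pos_signed; exists j, l.
- by case=> hA /sigma_pos_nontrivial.
- case=> hA [psi [[[hpsi _] _] e] /sigma_pos_nontrivial[] k hk].
  rewrite -e // /acomp hA // ext_gen reduce_id //.
  by have := hpsi k hk; rewrite in_FE => /andP[].
(* If [phi] and its inverse [psi] were both positive, their product [1] would be positive. *)
- by case=> hB [psi [_ e] hpsi]; apply: (sigma_pos_nontrivial (sigma_pos_acomp hB hpsi)).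
Qed.
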